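(* Let $G$ be a $\sigma$-compact locally compact Abelian group and $\Lambda\subset G$ an almost lattice. Then $\Lambda$ is a subset of a model set.
   Context: $\Lambda$ is an almost lattice if it is relatively dense, locally finite, and there is a finite set $F$ with $\Lambda-\Lambda\subset\Lambda+F$. A cut and project scheme $(G\times H,\widetilde L)$: $H$ a locally compact Abelian group, $\widetilde L\subset G\times H$ a discrete cocompact subgroup with $\pi_1|_{\widetilde L}$ injective and $\pi_2(\widetilde L)$ dense; $x^\star:=\pi_2((\pi_1|_{\widetilde L})^{-1}(x))$. A model set is $\Lambda(W):=\{x\in\pi_1(\widetilde L):x^\star\in W\}$ with $W\subset H$ precompact with nonempty interior. *)

(* Defs.v *)
From Stdlib Require Import List.
Set Implicit Arguments.

Definition set (X : Type) := X -> Prop.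

Record TopAbGroup := {
  tg_car :> Type;
  tg_zero : tg_car;
  tg_add : tg_car -> tg_car -> tg_car;
  tg_opp : tg_car -> tg_car;
  tg_open : set tg_car -> Prop;
  tg_addA : forall x y z, tg_add x (tg_add y z) = tg_add (tg_add x y) z;
  tg_addC : forall x y, tg_add x y = tg_add y x;
  tg_add0 : forall x, tg_add tg_zero x = x;
  tg_addN : forall x, tg_add (tg_opp x) x = tg_zero;
  tg_open_ext : forall U V : set tg_car,
      (forall x, U x <-> V x) -> tg_open U -> tg_open V;
  tg_open_full : tg_open (fun _ => True);
  tg_open_union : forall (I : Type) (U : I -> set tg_car),
      (forall i, tg_open (U i)) -> tg_open (fun x => exists i, U i x);
  tg_open_inter : forall U V : set tg_car,
      tg_open U -> tg_open V -> tg_open (fun x => U x /\ V x);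
  tg_add_cont : forall (W : set tg_car) x y, tg_open W -> W (tg_add x y) ->
      exists U V : set tg_car, tg_open U /\ tg_open V /\ U x /\ V y /\
        (forall u v, U u -> V v -> W (tg_add u v));
  tg_opp_cont : forall (W : set tg_car) x, tg_open W -> W (tg_opp x) ->
      exists U : set tg_car, tg_open U /\ U x /\ (forall u, U u -> W (tg_opp u));
  tg_hausdorff : forall x y, x <> y ->
      exists U V : set tg_car, tg_open U /\ tg_open V /\ U x /\ V y /\
        (forall z, U z -> V z -> False)
}.

Arguments tg_zero {t}.
Arguments tg_add {t}.
Arguments tg_opp {t}.
Arguments tg_open {t}.

Definition tg_sub {G : TopAbGroup} (x y : G) : G := tg_add x (tg_opp y).

Definition compact_wrt {X : Type} (opn : set X -> Prop) (K : set X) : Prop :=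
  forall (I : Type) (U : I -> set X),
    (forall i, opn (U i)) ->
    (forall x, K x -> exists i, U i x) ->
    exists l : list I, forall x, K x -> exists i, In i l /\ U i x.

Definition closure_wrt {X : Type} (opn : set X -> Prop) (A : set X) : set X :=
  fun x => forall V : set X, opn V -> V x -> exists a, A a /\ V a.

Definition compact {G : TopAbGroup} (K : set G) : Prop := compact_wrt (@tg_open G) K.

Definition precompact {G : TopAbGroup} (W : set G) : Prop :=
  compact (closure_wrt (@tg_open G) W).

Definition nonempty_interior {G : TopAbGroup} (W : set G) : Prop :=
  exists V : set G, tg_open V /\ (exists v, V v) /\ (forall v, V v -> W v).

Definition dense {G : TopAbGroup} (A : set G) : Prop :=
  forall x, closure_wrt (@tg_open G) A x.

Definition locally_compact (G : TopAbGroup) : Prop :=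
  forall x : G, exists (U K : set G),
    tg_open U /\ compact K /\ U x /\ (forall y, U y -> K y).

Definition sigma_compact (G : TopAbGroup) : Prop :=
  exists K : nat -> set G, (forall n, compact (K n)) /\
    (forall x, exists n, K n x).

Definition finite_set {X : Type} (A : set X) : Prop :=
  exists l : list X, forall x, A x -> In x l.

Definition relatively_dense {G : TopAbGroup} (Lam : set G) : Prop :=
  exists K : set G, compact K /\
    forall g : G, exists l k, Lam l /\ K k /\ g = tg_add l k.

Definition locally_finite {G : TopAbGroup} (Lam : set G) : Prop :=
  forall K : set G, compact K -> finite_set (fun x => Lam x /\ K x).

Definition almost_lattice {G : TopAbGroup} (Lam : set G) : Prop :=
  relatively_dense Lam /\ locally_finite Lam /\
  exists F : list G, forall x y, Lam x -> Lam y ->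
    exists z f, Lam z /\ In f F /\ tg_sub x y = tg_add z f.

Definition prod_open {G H : TopAbGroup} (W : set (G * H)) : Prop :=
  forall p, W p -> exists (U : set G) (V : set H),
    tg_open U /\ tg_open V /\ U (fst p) /\ V (snd p) /\
    (forall a b, U a -> V b -> W (a, b)).

Definition prod_add {G H : TopAbGroup} (p q : G * H) : G * H :=
  (tg_add (fst p) (fst q), tg_add (snd p) (snd q)).

Definition prod_sub {G H : TopAbGroup} (p q : G * H) : G * H :=
  (tg_sub (fst p) (fst q), tg_sub (snd p) (snd q)).

Definition subgroup_prod {G H : TopAbGroup} (L : set (G * H)) : Prop :=
  L (tg_zero, tg_zero) /\ forall p q, L p -> L q -> L (prod_sub p q).

Definition discrete_prod {G H : TopAbGroup} (L : set (G * H)) : Prop :=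
  forall p, L p -> exists W, prod_open W /\ W p /\ (forall q, L q -> W q -> q = p).

(* the quotient (G x H)/L is compact: open sets of the quotient correspond
   to L-invariant open sets of G x H *)
Definition cocompact_prod {G H : TopAbGroup} (L : set (G * H)) : Prop :=
  forall (I : Type) (U : I -> set (G * H)),
    (forall i, prod_open (U i)) ->
    (forall i p l, U i p -> L l -> U i (prod_add p l)) ->
    (forall p, exists i, U i p) ->
    exists li : list I, forall p, exists i, In i li /\ U i p.

Definition cut_and_project {G H : TopAbGroup} (L : set (G * H)) : Prop :=
  subgroup_prod L /\ discrete_prod L /\ cocompact_prod L /\
  (forall p q, L p -> L q -> fst p = fst q -> p = q) /\
  dense (fun h : H => exists p, L p /\ snd p = h).

(** Model set Lambda(W) = { x in pi1(L) : x^star in W }, where x^star is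
    the second coordinate of the unique lift of x in L. *)
Definition model_set {G H : TopAbGroup} (L : set (G * H)) (W : set H) : set G :=
  fun x => exists p, L p /\ fst p = x /\ W (snd p).

(* Main.v *)
(* Let [L] be the group generated by [Lam]. The condition [Lam - Lam c Lam + F] gives
   [L c Lam + Z F], and we choose a list [I] of minimal length such that
   [L c Lam + finite + Z I]. Let [B] be the set of the integer vectors [n] with
   [sum_(g in I) n(g) g] in [Lam - Lam]; up to a bounded error [B] is closed under
   differences. If [B] were unbounded in a coordinate [g], its projection to that
   coordinate would be coarsely dense in [Z] and [g] could be dropped from [I]. So [B]
   is bounded, and the coefficient vector of an element of [L] is a quasimorphism
   [L -> Z^I] with bounded defect. It is at bounded distance from a homomorphism
   [phi : L -> R^I]. This [phi] is bounded on [Lam], and the preimage under [phi] of a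
   bounded set lies in finitely many translates of [Lam]. The internal space is the
   closure of [phi L] in [R^I], the lattice is the graph of [phi], and the window is a
   ball. *)

From Stdlib Require Import List ZArith Lia Reals Lra Classical ClassicalEpsilon.
From Stdlib Require Import FunctionalExtensionality ProofIrrelevance.
Require Import Defs.
Import ListNotations.

(** * Integer multiples in abelian groups *)

Fixpoint nmul {G : TopAbGroup} (n : nat) (x : G) : G :=
  match n with O => tg_zero | S m => tg_add x (nmul m x) end.

(** At least one of the two truncated multiples is zero, so the sign of [z] is handled without a
    case split. *)
Definition zmul {G : TopAbGroup} (z : Z) (x : G) : G :=
  tg_sub (nmul (Z.to_nat z) x) (nmul (Z.to_nat (- z)) x).

Lemma tg_addr0 (G : TopAbGroup) (x : G) : tg_add x tg_zero = x.
Proof. rewrite tg_addC; apply tg_add0. Qed.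

Lemma tg_addrN (G : TopAbGroup) (x : G) : tg_add x (tg_opp x) = tg_zero.
Proof. rewrite tg_addC; apply tg_addN. Qed.

Lemma tg_addACA (G : TopAbGroup) (a b c d : G) :
  tg_add (tg_add a b) (tg_add c d) = tg_add (tg_add a c) (tg_add b d).
Proof.
  rewrite <- !tg_addA, (tg_addA _ b c d), (tg_addC _ b c), <- (tg_addA _ c b d).
  reflexivity.
Qed.

Lemma tg_add_cancel (G : TopAbGroup) (a b c : G) :
  tg_add a c = tg_add b c -> a = b.
Proof.
  intros h.
  rewrite <- (tg_addr0 G a), <- (tg_addr0 G b), <- (tg_addrN G c), !tg_addA, h.
  reflexivity.
Qed.

Lemma tg_opp_unique (G : TopAbGroup) (a b : G) :
  tg_add a b = tg_zero -> a = tg_opp b.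
Proof. intros h; apply tg_add_cancel with b; rewrite h, tg_addN; reflexivity. Qed.

Lemma tg_oppD (G : TopAbGroup) (a b : G) :
  tg_opp (tg_add a b) = tg_add (tg_opp a) (tg_opp b).
Proof.
  symmetry; apply tg_opp_unique.
  rewrite tg_addACA, !tg_addN; apply tg_add0.
Qed.

Lemma tg_oppK (G : TopAbGroup) (a : G) : tg_opp (tg_opp a) = a.
Proof. symmetry; apply tg_opp_unique, tg_addrN. Qed.

Lemma tg_opp0 (G : TopAbGroup) : tg_opp (tg_zero : G) = tg_zero.
Proof. symmetry; apply tg_opp_unique, tg_add0. Qed.

Lemma nmulD (G : TopAbGroup) (m n : nat) (x : G) :
  nmul (m + n) x = tg_add (nmul m x) (nmul n x).
Proof.
  induction m as [|m IH]; simpl.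
  - rewrite tg_add0; reflexivity.
  - rewrite IH, tg_addA; reflexivity.
Qed.

Lemma nmulM (G : TopAbGroup) (m n : nat) (x : G) :
  nmul m (nmul n x) = nmul (m * n) x.
Proof.
  induction m as [|m IH]; simpl; [reflexivity|].
  rewrite nmulD, IH; reflexivity.
Qed.

Lemma nmul_add (G : TopAbGroup) (n : nat) (x y : G) :
  nmul n (tg_add x y) = tg_add (nmul n x) (nmul n y).
Proof.
  induction n as [|n IH]; simpl.
  - rewrite tg_add0; reflexivity.
  - rewrite IH; apply tg_addACA.
Qed.

Lemma tg_sub_eq (G : TopAbGroup) (a b c d : G) :
  tg_add a d = tg_add c b -> tg_sub a b = tg_sub c d.
Proof.
  intros h; unfold tg_sub; apply tg_add_cancel with (tg_add b d).
  rewrite (tg_addC _ b d) at 2.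
  rewrite <- !tg_addA, (tg_addA _ (tg_opp b)), (tg_addA _ (tg_opp d)), !tg_addN, !tg_add0.
  exact h.
Qed.

Lemma nmul_zmul (G : TopAbGroup) (a b : nat) (x : G) :
  tg_sub (nmul a x) (nmul b x) = zmul (Z.of_nat a - Z.of_nat b) x.
Proof.
  unfold zmul; apply tg_sub_eq; rewrite <- !nmulD; f_equal; lia.
Qed.

Lemma zmulD (G : TopAbGroup) (a b : Z) (x : G) :
  zmul (a + b) x = tg_add (zmul a x) (zmul b x).
Proof.
  replace (a + b)%Z with
    (Z.of_nat (Z.to_nat a + Z.to_nat b) - Z.of_nat (Z.to_nat (- a) + Z.to_nat (- b)))%Z by lia.
  rewrite <- nmul_zmul; unfold zmul, tg_sub.
  rewrite !nmulD, tg_oppD; apply tg_addACA.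
Qed.

Lemma zmulN (G : TopAbGroup) (a : Z) (x : G) : zmul (- a) x = tg_opp (zmul a x).
Proof.
  unfold zmul, tg_sub; rewrite tg_oppD, tg_oppK, Z.opp_involutive; apply tg_addC.
Qed.

Lemma zmul0 (G : TopAbGroup) (x : G) : zmul 0 x = tg_zero.
Proof. apply tg_addrN. Qed.

Lemma zmul1 (G : TopAbGroup) (x : G) : zmul 1 x = x.
Proof. unfold zmul, tg_sub; simpl; rewrite tg_opp0, !tg_addr0; reflexivity. Qed.

(** * Deciding identities in abelian groups *)

Inductive aexp := AVar (n : nat) | AZero | AAdd (a b : aexp) | AOpp (a : aexp).

Fixpoint aeval {G : TopAbGroup} (env : list G) (e : aexp) : G :=
  match e with
  | AVar n => nth n env tg_zero
  | AZero => tg_zero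
  | AAdd a b => tg_add (aeval env a) (aeval env b)
  | AOpp a => tg_opp (aeval env a)
  end.

Fixpoint acoef (e : aexp) (i : nat) : Z :=
  match e with
  | AVar n => if Nat.eqb n i then 1%Z else 0%Z
  | AZero => 0%Z
  | AAdd a b => (acoef a i + acoef b i)%Z
  | AOpp a => (- acoef a i)%Z
  end.

Fixpoint lincomb {G : TopAbGroup} (c : nat -> Z) (env : list G) : G :=
  match env with
  | [] => tg_zero
  | x :: r => tg_add (zmul (c O) x) (lincomb (fun i => c (S i)) r)
  end.

Lemma lincomb0 (G : TopAbGroup) (env : list G) (c : nat -> Z) :
  (forall i, (i < length env)%nat -> c i = 0%Z) -> lincomb c env = tg_zero.
Proof.
  revert c; induction env as [|x r IH]; intros c hc; simpl; [reflexivity|].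
  rewrite hc by (simpl; lia); rewrite zmul0, tg_add0; apply IH.
  intros i hi; apply hc; simpl; lia.
Qed.

Lemma lincombD (G : TopAbGroup) (env : list G) (c d : nat -> Z) :
  lincomb (fun i => (c i + d i)%Z) env = tg_add (lincomb c env) (lincomb d env).
Proof.
  revert c d; induction env as [|x r IH]; intros c d; simpl.
  - rewrite tg_add0; reflexivity.
  - rewrite (IH (fun i => c (S i)) (fun i => d (S i))), zmulD; apply tg_addACA.
Qed.

Lemma lincombN (G : TopAbGroup) (env : list G) (c : nat -> Z) :
  lincomb (fun i => (- c i)%Z) env = tg_opp (lincomb c env).
Proof.
  revert c; induction env as [|x r IH]; intros c; simpl.
  - rewrite tg_opp0; reflexivity.
  - rewrite (IH (fun i => c (S i))), zmulN, tg_oppD; reflexivity.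
Qed.

Lemma lincomb_var (G : TopAbGroup) (env : list G) (n : nat) :
  lincomb (acoef (AVar n)) env = nth n env tg_zero.
Proof.
  revert n; induction env as [|x r IH]; intros [|n]; simpl; try reflexivity.
  - rewrite zmul1; rewrite lincomb0 by reflexivity; apply tg_addr0.
  - rewrite zmul0, tg_add0; apply (IH n).
Qed.

Lemma aeval_lincomb (G : TopAbGroup) (env : list G) (e : aexp) :
  aeval env e = lincomb (acoef e) env.
Proof.
  induction e as [n| |a IHa b IHb|a IHa]; simpl.
  - rewrite <- lincomb_var; reflexivity.
  - symmetry; apply lincomb0; reflexivity.
  - rewrite IHa, IHb, <- lincombD; reflexivity.
  - rewrite IHa, <- lincombN; reflexivity.
Qed.

(** Both expressions normalize to integer combinations of the variables, so comparing finitely many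
    coefficients, by computation, is enough. *)
Lemma aeval_eq (G : TopAbGroup) (env : list G) (a b : aexp) :
  forallb (fun i => Z.eqb (acoef a i) (acoef b i)) (seq 0 (length env)) = true ->
  aeval env a = aeval env b.
Proof.
  intros h.
  rewrite forallb_forall in h.
  assert (h0 : lincomb (fun i => (acoef a i + - acoef b i)%Z) env = tg_zero).
  { apply lincomb0; intros i hi.
    assert (hi' : In i (seq 0 (length env))) by (apply in_seq; lia).
    apply h, Z.eqb_eq in hi'; lia. }
  rewrite lincombD, lincombN in h0.
  rewrite !aeval_lincomb; apply tg_opp_unique in h0; rewrite h0; apply tg_oppK.
Qed.

Ltac alist_add x env :=
  lazymatch env with
  | context [ cons x _ ] => env
  | _ => constr:(cons x env)
  end.

Ltac avars env t :=
  lazymatch t with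
  | tg_add ?a ?b => let e := avars env a in avars e b
  | tg_sub ?a ?b => let e := avars env a in avars e b
  | tg_opp ?a => avars env a
  | tg_zero => env
  | _ => alist_add t env
  end.

Ltac aindex x env :=
  lazymatch env with
  | cons x _ => constr:(O)
  | cons _ ?r => let n := aindex x r in constr:(S n)
  end.

Ltac areify env t :=
  lazymatch t with
  | tg_add ?a ?b => let x := areify env a in let y := areify env b in constr:(AAdd x y)
  | tg_sub ?a ?b => let x := areify env a in let y := areify env b in
                    constr:(AAdd x (AOpp y))
  | tg_opp ?a => let x := areify env a in constr:(AOpp x)
  | tg_zero => constr:(AZero)
  | _ => let n := aindex t env in constr:(AVar n)
  end.

Ltac abel :=
  lazymatch goal with
  | |- @eq ?T ?a ?b =>
    let env := avars (@nil T) a in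
    let env := avars env b in
    let x := areify env a in
    let y := areify env b in
    apply (@aeval_eq _ env x y); vm_compute; reflexivity
  end.


Lemma tg_subrK (G : TopAbGroup) (x y : G) : tg_add (tg_sub x y) y = x.
Proof. abel. Qed.

(** * Approximate groups and coefficient vectors *)

(** Coefficients are indexed by group elements rather than positions, so the same vector still makes
    sense after an element is dropped from the list. *)
Fixpoint esum {G : TopAbGroup} (I : list G) (n : G -> Z) : G :=
  match I with
  | [] => tg_zero
  | g :: J => tg_add (zmul (n g) g) (esum J n)
  end.

Lemma esum_sub (G : TopAbGroup) (I : list G) (n m : G -> Z) :
  esum I (fun g => (n g - m g)%Z) = tg_sub (esum I n) (esum I m).
Proof.
  induction I as [|g J IH]; simpl; [abel|].
  rewrite IH; unfold Z.sub; rewrite zmulD, zmulN; abel.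
Qed.

Lemma esum_ext (G : TopAbGroup) (I : list G) (n m : G -> Z) :
  (forall g, In g I -> n g = m g) -> esum I n = esum I m.
Proof.
  induction I as [|g J IH]; simpl; intros h; [reflexivity|].
  rewrite (h g), IH; auto.
Qed.

Lemma esum0 (G : TopAbGroup) (I : list G) : esum I (fun _ => 0%Z) = tg_zero.
Proof.
  induction I as [|g J IH]; simpl; [reflexivity|].
  rewrite IH, zmul0; abel.
Qed.

Lemma esum_remove (G : TopAbGroup) (I J : list G) (g : G) (n : G -> Z) :
  esum (I ++ g :: J) n = tg_add (zmul (n g) g) (esum (I ++ J) n).
Proof.
  induction I as [|h I IH]; simpl; [reflexivity|].
  rewrite IH; abel.
Qed.

(** The indicator of [f] works; without [NoDup] it would count [f] once per occurrence. *)
Lemma esum_surj (G : TopAbGroup) (I : list G) (f : G) :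
  NoDup I -> In f I -> exists n, esum I n = f.
Proof.
  intros hI hf.
  exists (fun x => if excluded_middle_informative (x = f) then 1%Z else 0%Z).
  destruct (in_split _ _ hf) as (I1 & I2 & ->).
  rewrite esum_remove; apply NoDup_remove_2 in hI.
  rewrite esum_ext with (m := fun _ => 0%Z).
  - destruct (excluded_middle_informative (f = f)) as [_|n]; [|congruence].
    rewrite esum0, zmul1; abel.
  - intros g hg; destruct (excluded_middle_informative (g = f)); congruence.
Qed.

(** * The generated group and finite unions of translates *)

Inductive gen {G : TopAbGroup} (Lam : set G) : set G :=
  | gen_in x : Lam x -> gen Lam x
  | gen_sub x y : gen Lam x -> gen Lam y -> gen Lam (tg_sub x y).

(** This is the notion of bounded error for the argument: once [Lam] is nonempty and
    [diffset Lam Lam] is covered, covered sets are stable under sums and differences. *)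
Definition covered {G : TopAbGroup} (Lam S : set G) : Prop :=
  exists E : list G, forall x, S x -> exists l e, Lam l /\ In e E /\ x = tg_add l e.

Definition sumset {G : TopAbGroup} (S T : set G) : set G :=
  fun x => exists s t, S s /\ T t /\ x = tg_add s t.

Definition diffset {G : TopAbGroup} (S T : set G) : set G :=
  fun x => exists s t, S s /\ T t /\ x = tg_sub s t.

Lemma gen0 (G : TopAbGroup) (Lam : set G) (l : G) : Lam l -> gen Lam tg_zero.
Proof.
  intros hl; replace (tg_zero : G) with (tg_sub l l) by abel.
  apply gen_sub; apply gen_in; exact hl.
Qed.

Lemma gen_opp (G : TopAbGroup) (Lam : set G) (x : G) : gen Lam x -> gen Lam (tg_opp x).
Proof.
  intros hx; replace (tg_opp x) with (tg_sub (tg_sub x x) x) by abel.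
  repeat apply gen_sub; exact hx.
Qed.

Lemma gen_add (G : TopAbGroup) (Lam : set G) (x y : G) :
  gen Lam x -> gen Lam y -> gen Lam (tg_add x y).
Proof.
  intros hx hy; replace (tg_add x y) with (tg_sub x (tg_opp y)) by abel.
  apply gen_sub; [|apply gen_opp]; assumption.
Qed.

Lemma covered_mono (G : TopAbGroup) (Lam S T : set G) :
  (forall x, S x -> T x) -> covered Lam T -> covered Lam S.
Proof. intros h [E hE]; exists E; intros x hx; apply hE, h, hx. Qed.

Lemma covered_self (G : TopAbGroup) (Lam : set G) : covered Lam Lam.
Proof.
  exists [tg_zero]; intros x hx; exists x, tg_zero; repeat split; simpl; auto; abel.
Qed.

Lemma covered_list (G : TopAbGroup) (Lam : set G) (l : G) (E : list G) :
  Lam l -> covered Lam (fun x => In x E).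
Proof.
  intros hl; exists (map (fun x => tg_sub x l) E); intros x hx.
  exists l, (tg_sub x l); repeat split; auto; [|abel].
  apply (in_map (fun x => tg_sub x l)); exact hx.
Qed.

(** Write [(l + e) - (l' + e')] as [(l - l') + (e - e')] and cover [l - l'] by [k + f]; the new
    translations are the [f + e - e']. *)
Lemma covered_diff (G : TopAbGroup) (Lam S T : set G) :
  covered Lam (diffset Lam Lam) -> covered Lam S -> covered Lam T ->
  covered Lam (diffset S T).
Proof.
  intros [F hF] [E hE] [E' hE'].
  exists (map (fun p => tg_add (fst p) (tg_sub (fst (snd p)) (snd (snd p))))
            (list_prod F (list_prod E E'))).
  intros x (s & t & hs & ht & ->).
  destruct (hE s hs) as (l & e & hl & he & ->).
  destruct (hE' t ht) as (l' & e' & hl' & he' & ->).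
  destruct (hF (tg_sub l l')) as (k & f & hk & hf & hkf).
  { exists l, l'; auto. }
  exists k, (tg_add f (tg_sub e e')); repeat split; auto.
  - apply in_map_iff; exists (f, (e, e')); split; [reflexivity|].
    apply in_prod; [|apply in_prod]; assumption.
  - rewrite tg_addA, <- hkf; abel.
Qed.

(** A sum is the double difference [s - (0 - t)]; the point [l] serves to cover the singleton of
    zero. *)
Lemma covered_sum (G : TopAbGroup) (Lam S T : set G) (l : G) :
  Lam l -> covered Lam (diffset Lam Lam) -> covered Lam S -> covered Lam T ->
  covered Lam (sumset S T).
Proof.
  intros hl hd hS hT.
  assert (hN : covered Lam (diffset S (diffset (fun x => In x [tg_zero]) T))).
  { apply covered_diff; auto; apply covered_diff; auto.
    apply covered_list with l; exact hl. }
  revert hN; apply covered_mono; intros x (s & t & hs & ht & ->).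
  exists s, (tg_sub tg_zero t); repeat split; auto; [|abel].
  exists tg_zero, t; simpl; auto.
Qed.

(** * Bounded coefficients and minimal spanning lists *)

Lemma list_bound {X : Type} (I : list X) (n : X -> Z) :
  exists R, (0 <= R)%Z /\ forall g, In g I -> (Z.abs (n g) <= R)%Z.
Proof.
  induction I as [|g J (R & h0 & hR)].
  - exists 0%Z; split; [lia|intros g []].
  - exists (Z.max R (Z.abs (n g))); split; [lia|].
    intros h [<-|hh]; [lia|specialize (hR h hh); lia].
Qed.

(* Two coefficient vectors whose sums lie in the same translate of [Lam] differ by a
   vector whose sum lies in [Lam - Lam]. *)
Lemma coef_near_diff (G : TopAbGroup) (Lam S : set G) (I : list G) :
  covered Lam S ->
  exists R, (0 <= R)%Z /\ forall n, S (esum I n) ->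
    exists b, diffset Lam Lam (esum I b) /\
      forall g, In g I -> (Z.abs (n g - b g) <= R)%Z.
Proof.
  intros [E hE].
  enough (h : exists R, (0 <= R)%Z /\ forall n,
    (exists l e, Lam l /\ In e E /\ esum I n = tg_add l e) ->
    exists b, diffset Lam Lam (esum I b) /\
      forall g, In g I -> (Z.abs (n g - b g) <= R)%Z).
  { destruct h as (R & h0 & hR); exists R; split; auto. }
  clear hE; induction E as [|e E (R & h0 & hR)].
  - exists 0%Z; split; [lia|]; intros n (l & e & _ & [] & _).
  (* One reference vector [m] is fixed for the translate by [e], if there is any; then [b = n - m]
     differs from [n] by a vector independent of [n]. *)
  - destruct (classic (exists m l, Lam l /\ esum I m = tg_add l e))
      as [(m & l & hl & hm)|no].
    + destruct (list_bound I m) as (R' & h0' & hR').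
      exists (Z.max R R'); split; [lia|]; intros n (k & f & hk & [<-|hf] & hn).
      * exists (fun g => (n g - m g)%Z); split.
        -- rewrite esum_sub, hn, hm; exists k, l; repeat split; auto; abel.
        -- intros g hg; specialize (hR' g hg); lia.
      * destruct (hR n) as (b & hb & hnb); [exists k, f; auto|].
        exists b; split; auto; intros g hg; specialize (hnb g hg); lia.
    + exists R; split; auto; intros n (k & f & hk & [<-|hf] & hn).
      * destruct no; exists n, k; auto.
      * apply hR; exists k, f; auto.
Qed.

(* Walking in steps [b + O(R)] from 0 never leaves a gap longer than [|b| + R]. *)
Lemma coarsely_dense (P : Z -> Prop) (R b : Z) :
  P 0%Z -> (forall a, P a -> P (- a)%Z) ->
  (forall a c, P a -> P c -> exists d, P d /\ (Z.abs (a - c - d) <= R)%Z) ->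
  P b -> (0 <= R < Z.abs b)%Z ->
  forall t, exists a, P a /\ (Z.abs (a - t) <= Z.abs b + R)%Z.
Proof.
  intros h0 hN hS hb hR.
  assert (hs : P (Z.abs b)).
  { destruct (Z.abs_spec b) as [[_ ->]|[_ ->]]; auto. }
  set (s := Z.abs b) in *; clearbody s.
  assert (hpos : forall k : nat, exists a, P a /\ (Z.abs (a - Z.of_nat k) <= s + R)%Z).
  { induction k as [|k (a & ha & hak)].
    - exists 0%Z; split; [exact h0|lia].
    - destruct (Z_le_gt_dec (Z.of_nat k - a) (s + R - 1)) as [h|h].
      + exists a; split; [exact ha|lia].
      + destruct (hS a (- s)%Z ha (hN s hs)) as (d & hd & hda).
        exists d; split; [exact hd|lia]. }
  intros t; destruct (Z_le_gt_dec 0 t) as [h|h].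
  - destruct (hpos (Z.to_nat t)) as (a & ha & hat); exists a; split; auto; lia.
  - destruct (hpos (Z.to_nat (- t))) as (a & ha & hat).
    exists (- a)%Z; split; auto; lia.
Qed.

Definition spans {G : TopAbGroup} (Lam : set G) (I : list G) : Prop :=
  exists T, covered Lam T /\
    forall x, gen Lam x -> exists t n, T t /\ x = tg_add t (esum I n).

(** A coarse form of linear independence: relations modulo [Lam - Lam] may exist, but only with
    bounded coefficients on [I]. *)
Definition independent {G : TopAbGroup} (Lam : set G) (I : list G) : Prop :=
  exists R, forall n, diffset Lam Lam (esum I n) ->
    forall g, In g I -> (Z.abs (n g) <= R)%Z.

Lemma zmul_interval (G : TopAbGroup) (M : Z) (g : G) :
  exists E : list G, forall z, (Z.abs z <= M)%Z -> In (zmul z g) E.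
Proof.
  exists (map (fun k => zmul (Z.of_nat k - M) g) (seq 0 (Z.to_nat (2 * M + 1)))).
  intros z hz; apply in_map_iff; exists (Z.to_nat (z + M)); split.
  - f_equal; lia.
  - apply in_seq; lia.
Qed.

Lemma spans_reduce (G : TopAbGroup) (Lam : set G) (l : G) (I : list G) :
  Lam l -> covered Lam (diffset Lam Lam) -> spans Lam I -> ~ independent Lam I ->
  exists J, (length J < length I)%nat /\ spans Lam J.
Proof.
  intros hl hd (T & hT & hspan) hdep.
  set (D := diffset Lam Lam) in *.
  (* [R] is the error with which vectors summing into [D] are closed under differences; a coordinate
     exceeding it in absolute value makes [coarsely_dense] applicable. *)
  destruct (coef_near_diff G Lam (diffset D D) I) as (R & hR0 & hR).
  { apply covered_diff; assumption. }
  assert (hb : exists b g, D (esum I b) /\ In g I /\ (R < Z.abs (b g))%Z).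
  { apply NNPP; intros no; apply hdep; exists R; intros n hn g hg.
    apply Znot_gt_le; intros h; apply no; exists n, g; repeat split; auto; lia. }
  destruct hb as (b & g & hDb & hg & hbg).
  assert (hdense : forall t, exists a, (exists x, D (esum I x) /\ x g = a) /\
                     (Z.abs (a - t) <= Z.abs (b g) + R)%Z).
  { apply coarsely_dense.
    - exists (fun _ => 0%Z); split; [|reflexivity].
      rewrite esum0; exists l, l; repeat split; auto; abel.
    - intros a (x & (u & v & hu & hv & huv) & <-).
      exists (fun i => (0 - x i)%Z); split; [|lia].
      rewrite (esum_sub _ I (fun _ => 0%Z)), esum0, huv.
      exists v, u; repeat split; auto; abel.
    - intros a c (x & hx & <-) (y & hy & <-).
      destruct (hR (fun i => (x i - y i)%Z)) as (z & hz & hxyz).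
      { rewrite esum_sub; exists (esum I x), (esum I y); auto. }
      exists (z g); split; [exists z; auto|apply (hxyz g hg)].
    - exists b; auto.
    - lia. }
  destruct (in_split _ _ hg) as (I1 & I2 & hI).
  exists (I1 ++ I2); split.
  { rewrite hI, !length_app; simpl; lia. }
  destruct (zmul_interval G (Z.abs (b g) + R) g) as (E & hE).
  (* Subtracting a vector [y] that sums into [D] makes the coefficient of [g] bounded. The remainder
     absorbs the sum of [y] in [D] and the leftover multiple of [g] in [E]. *)
  exists (sumset (sumset T D) (fun x => In x E)); split.
  { apply covered_sum with l; auto; [apply covered_sum with l; auto|].
    apply covered_list with l; auto. }
  intros x hx; destruct (hspan x hx) as (t & n & ht & ->).
  destruct (hdense (n g)) as (a & (y & hy & <-) & hny).
  exists (tg_add (tg_add t (esum I y)) (zmul (n g - y g) g)).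
  exists (fun i => (n i - y i)%Z); split.
  - exists (tg_add t (esum I y)), (zmul (n g - y g) g); repeat split; auto.
    + exists t, (esum I y); auto.
    + apply hE; lia.
  - rewrite <- !tg_addA; f_equal.
    rewrite <- (esum_remove _ I1 I2 g (fun i => (n i - y i)%Z)), <- hI, esum_sub; abel.
Qed.

(** Each application of [spans_reduce] shortens the list, so the descent ends at an independent
    one. *)
Lemma exists_independent_spans (G : TopAbGroup) (Lam : set G) (l : G) :
  Lam l -> covered Lam (diffset Lam Lam) ->
  exists I, spans Lam I /\ independent Lam I.
Proof.
  intros hl hd.
  assert (h0 : exists I, spans Lam I).
  { destruct hd as [F hF].
    assert (hdec : forall x y : G, {x = y} + {x <> y})
      by (intros; apply excluded_middle_informative).
    (* The descent starts from [F] with remainders in [Lam] itself: each subtraction of two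
       remainders gives a new remainder plus one element of [F]. *)
    exists (nodup hdec F), Lam; split; [apply covered_self|].
    intros x hx; induction hx as [x hx|x y hx IHx hy IHy].
    - exists x, (fun _ => 0%Z); split; auto; rewrite esum0; abel.
    - destruct IHx as (t & n & ht & ->); destruct IHy as (u & m & hu & ->).
      destruct (hF (tg_sub t u)) as (v & f & hv & hf & htu); [exists t, u; auto|].
      destruct (esum_surj G (nodup hdec F) f) as [k hk].
      { apply NoDup_nodup. }
      { apply nodup_In; exact hf. }
      exists v, (fun i => (k i - (m i - n i))%Z); split; auto.
      rewrite (esum_sub _ _ k), (esum_sub _ _ m), hk.
      transitivity (tg_add (tg_add v f)
        (tg_sub (esum (nodup hdec F) n) (esum (nodup hdec F) m))); [rewrite <- htu|]; abel. }
  destruct h0 as [I hI].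
  assert (h : forall k J, (length J < k)%nat -> spans Lam J ->
            exists I, spans Lam I /\ independent Lam I).
  { induction k as [|k IH]; intros J hJ hs; [lia|].
    destruct (classic (independent Lam J)) as [hi|hi]; [exists J; auto|].
    destruct (spans_reduce G Lam l J hl hd hs hi) as (J' & hlt & hs').
    apply (IH J'); [lia|exact hs']. }
  apply (h (S (length I)) I); [lia|exact hI].
Qed.

(** Independence controls sums in [Lam - Lam]; by [coef_near_diff], any covered set costs only a
    further bounded change of coefficients. *)
Lemma independent_bounded (G : TopAbGroup) (Lam S : set G) (I : list G) :
  independent Lam I -> covered Lam S ->
  exists R, forall n, S (esum I n) -> forall g, In g I -> (Z.abs (n g) <= R)%Z.
Proof.
  intros [R hR] hS.
  destruct (coef_near_diff G Lam S I hS) as (R' & _ & hR').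
  exists (R + R')%Z; intros n hn g hg.
  destruct (hR' n hn) as (b & hb & hnb).
  specialize (hR b hb g hg); specialize (hnb g hg); lia.
Qed.

(** * The star map *)

Local Open Scope R_scope.

Lemma choice_of {X Y : Type} (P : X -> Y -> Prop) :
  (forall x, exists y, P x y) -> exists f, forall x, P x (f x).
Proof.
  intros h.
  exists (fun x => proj1_sig (constructive_indefinite_description _ (h x))).
  intros x; apply (proj2_sig (constructive_indefinite_description _ (h x))).
Qed.

Lemma eq0_of_nmul_bounded (x C : R) :
  (forall n : nat, INR (S n) * Rabs x <= C) -> x = 0.
Proof.
  intros h; destruct (Req_dec x 0) as [h0|h0]; [exact h0|exfalso].
  assert (hx := Rabs_pos_lt x h0).
  assert (hC : 0 <= C) by (specialize (h 0%nat); simpl in h; lra).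
  destruct (INR_unbounded (C / Rabs x)) as [n hn].
  specialize (h n); rewrite S_INR in h.
  assert (C < INR n * Rabs x).
  { apply (Rmult_lt_compat_r (Rabs x)) in hn; [|exact hx].
    unfold Rdiv in hn; rewrite Rmult_assoc, Rinv_l in hn; lra. }
  lra.
Qed.

(** * Homogenization of quasimorphisms *)

Definition quasimorphism {G : TopAbGroup} (L : set G) (f : G -> R) (C : R) : Prop :=
  forall x y, L x -> L y -> Rabs (f (tg_add x y) - f x - f y) <= C.

Lemma quasimorphism_nmul (G : TopAbGroup) (L : set G) (f : G -> R) (C : R) :
  L tg_zero -> (forall x y, L x -> L y -> L (tg_add x y)) -> quasimorphism L f C ->
  forall n x, L x ->
    L (nmul n x) /\ Rabs (f (nmul n x) - INR n * f x) <= (INR n + 1) * C.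
Proof.
  intros hL0 hLD hf n x hx; induction n as [|n [hn IH]].
  (* The defect at the pair of zeros gives [|f 0| <= C], which is the extra [C] in the bound. *)
  - split; [exact hL0|]; simpl.
    assert (h := hf tg_zero tg_zero hL0 hL0); rewrite tg_add0 in h.
    revert h; unfold Rabs; repeat destruct Rcase_abs; lra.
  - simpl nmul; split; [auto|]; rewrite S_INR.
    specialize (hf x (nmul n x) hx hn).
    revert hf IH; unfold Rabs; repeat destruct Rcase_abs; lra.
Qed.

(* The value at [x] is the supremum of [(f (m x) - 2 C) / m] over [m >= 1]. *)
Lemma homogenize_at (G : TopAbGroup) (L : set G) (f : G -> R) (C : R) (x : G) :
  L tg_zero -> (forall x y, L x -> L y -> L (tg_add x y)) -> quasimorphism L f C ->
  L x -> exists v, forall n, Rabs (f (nmul (S n) x) - INR (S n) * v) <= 2 * C.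
Proof.
  intros hL0 hLD hf hx.
  assert (hC : 0 <= C) by (eapply Rle_trans; [apply Rabs_pos|apply (hf x x hx hx)]).
  (* Cleared of denominators, every lower quotient is below every upper one. Both are compared with
     the value of [f] at the common multiple [(n + 1)(m + 1) x]. *)
  assert (hmn : forall m n : nat,
    INR (S n) * (f (nmul (S m) x) - 2 * C) <= INR (S m) * (f (nmul (S n) x) + 2 * C)).
  { intros m n.
    destruct (quasimorphism_nmul G L f C hL0 hLD hf (S m) x hx) as [hm _].
    destruct (quasimorphism_nmul G L f C hL0 hLD hf (S n) x hx) as [hn _].
    destruct (quasimorphism_nmul G L f C hL0 hLD hf (S n) _ hm) as [_ h1].
    destruct (quasimorphism_nmul G L f C hL0 hLD hf (S m) _ hn) as [_ h2].
    rewrite nmulM in h1, h2; rewrite (Nat.mul_comm (S m)) in h2.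
    assert (1 <= INR (S n)) by (rewrite S_INR; pose proof (pos_INR n); lra).
    assert (1 <= INR (S m)) by (rewrite S_INR; pose proof (pos_INR m); lra).
    set (p := INR (S n)) in *; set (q := INR (S m)) in *.
    set (u := f (nmul (S n * S m) x)) in *.
    (* As [p >= 1], the error [(p + 1) C] is at most [2 p C], and likewise for [q]; hence the
       constant [2 C]. *)
    assert (0 <= (p - 1) * C) by (apply Rmult_le_pos; lra).
    assert (0 <= (q - 1) * C) by (apply Rmult_le_pos; lra).
    revert h1 h2; unfold Rabs; repeat destruct Rcase_abs; lra. }
  assert (hdiv : forall m n,
    (f (nmul (S m) x) - 2 * C) / INR (S m) <= (f (nmul (S n) x) + 2 * C) / INR (S n)).
  { intros m n.
    assert (hp : 0 < INR (S n)) by (apply lt_0_INR; lia).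
    assert (hq : 0 < INR (S m)) by (apply lt_0_INR; lia).
    apply Rmult_le_reg_r with (INR (S n) * INR (S m)); [apply Rmult_lt_0_compat; lra|].
    specialize (hmn m n).
    replace ((f (nmul (S m) x) - 2 * C) / INR (S m) * (INR (S n) * INR (S m)))
      with (INR (S n) * (f (nmul (S m) x) - 2 * C)) by (field; lra).
    replace ((f (nmul (S n) x) + 2 * C) / INR (S n) * (INR (S n) * INR (S m)))
      with (INR (S m) * (f (nmul (S n) x) + 2 * C)) by (field; lra).
    exact hmn. }
  destruct (completeness (fun r => exists m, r = (f (nmul (S m) x) - 2 * C) / INR (S m)))
    as [v [hub hlub]].
  { exists ((f (nmul 1 x) + 2 * C) / INR 1); intros r [m ->]; apply hdiv. }
  { exists ((f (nmul 1 x) - 2 * C) / INR 1); exists 0%nat; reflexivity. }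
  exists v; intros n.
  assert (hp : 0 < INR (S n)) by (apply lt_0_INR; lia).
  assert (h1 : (f (nmul (S n) x) - 2 * C) / INR (S n) <= v) by (apply hub; exists n; auto).
  assert (h2 : v <= (f (nmul (S n) x) + 2 * C) / INR (S n)).
  { apply hlub; intros r [m ->]; apply hdiv. }
  apply (Rmult_le_compat_l (INR (S n))) in h1; [|lra].
  apply (Rmult_le_compat_l (INR (S n))) in h2; [|lra].
  replace (INR (S n) * ((f (nmul (S n) x) - 2 * C) / INR (S n)))
    with (f (nmul (S n) x) - 2 * C) in h1 by (field; lra).
  replace (INR (S n) * ((f (nmul (S n) x) + 2 * C) / INR (S n)))
    with (f (nmul (S n) x) + 2 * C) in h2 by (field; lra).
  apply Rabs_le; lra.
Qed.

Lemma homogenize (G : TopAbGroup) (L : set G) (f : G -> R) (C : R) :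
  L tg_zero -> (forall x y, L x -> L y -> L (tg_add x y)) -> quasimorphism L f C ->
  exists phi : G -> R,
    (forall x y, L x -> L y -> phi (tg_add x y) = phi x + phi y) /\
    (forall x, L x -> Rabs (phi x - f x) <= 2 * C).
Proof.
  intros hL0 hLD hf.
  destruct (choice_of (fun x v => L x ->
    forall n, Rabs (f (nmul (S n) x) - INR (S n) * v) <= 2 * C)) as [phi hphi].
  { intros x; destruct (classic (L x)) as [hx|hx].
    - destruct (homogenize_at G L f C x hL0 hLD hf hx) as [v hv]; exists v; auto.
    - exists 0; contradiction. }
  exists phi; split.
  - intros x y hx hy.
    apply Rminus_diag_uniq.
    (* Multiplied by [n + 1], the additivity defect of [phi] is at most three homogenization errors
       [2 C] plus one defect [C] of [f], uniformly in [n]. *)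
    apply (eq0_of_nmul_bounded _ (7 * C)); intros n.
    destruct (quasimorphism_nmul G L f C hL0 hLD hf (S n) x hx) as [hx' _].
    destruct (quasimorphism_nmul G L f C hL0 hLD hf (S n) y hy) as [hy' _].
    assert (h1 := hphi x hx n).
    assert (h2 := hphi y hy n).
    assert (h3 := hphi (tg_add x y) (hLD x y hx hy) n).
    rewrite nmul_add in h3.
    assert (h4 := hf _ _ hx' hy').
    assert (hp : 0 < INR (S n)) by (apply lt_0_INR; lia).
    rewrite <- (Rabs_pos_eq (INR (S n))) by lra; rewrite <- Rabs_mult.
    set (p := INR (S n)) in *; clearbody p.
    assert (hC : 0 <= C) by (eapply Rle_trans; [apply Rabs_pos|exact h4]).
    revert h1 h2 h3 h4; unfold Rabs; repeat destruct Rcase_abs; lra.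
  - intros x hx; specialize (hphi x hx 0%nat); simpl in hphi.
    rewrite tg_addr0 in hphi; rewrite Rabs_minus_sym.
    replace (f x - phi x) with (f x - 1 * phi x) by ring; exact hphi.
Qed.

Lemma bounded_esum (G : TopAbGroup) (M : Z) (I : list G) :
  exists E : list G, forall n,
    (forall g, In g I -> (Z.abs (n g) <= M)%Z) -> In (esum I n) E.
Proof.
  induction I as [|g J [E hE]].
  - exists [tg_zero]; intros n _; simpl; auto.
  - destruct (zmul_interval G M g) as [E' hE'].
    exists (map (fun p => tg_add (fst p) (snd p)) (list_prod E' E)); intros n hn.
    simpl; apply in_map_iff; exists (zmul (n g) g, esum J n); split; [reflexivity|].
    apply in_prod.
    + apply hE', hn; simpl; auto.
    + apply hE; intros h hh; apply hn; simpl; auto.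
Qed.

(** The clauses serve the scheme in turn: additivity makes the graph a subgroup, finite support
    makes the internal space Euclidean, boundedness on [Lam] gives window and cocompactness, and the
    covering of bounded preimages gives discreteness. *)
Lemma exists_star_map (G : TopAbGroup) (Lam : set G) (l : G) :
  Lam l -> covered Lam (diffset Lam Lam) ->
  exists (I : list G) (phi : G -> G -> R),
    (forall x y, gen Lam x -> gen Lam y -> forall g,
       phi (tg_add x y) g = phi x g + phi y g) /\
    (forall x g, ~ In g I -> phi x g = 0) /\
    (exists C, forall x, Lam x -> forall g, Rabs (phi x g) <= C) /\
    (forall M, covered Lam (fun x => gen Lam x /\ forall g, Rabs (phi x g) <= M)).
Proof.
  intros hl hd.
  destruct (exists_independent_spans G Lam l hl hd) as (I & (T & hT & hspan) & hind).
  destruct (choice_of (fun x n => gen Lam x -> T (tg_sub x (esum I n)))) as [f hf].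
  { intros x; destruct (classic (gen Lam x)) as [hx|hx].
    - destruct (hspan x hx) as (t & n & ht & ->); exists n; intros _.
      replace (tg_sub _ _) with t by abel; exact ht.
    - exists (fun _ => 0%Z); contradiction. }
  (* The vector [f x + f y - f (x + y)] sums to the remainder of [x + y] minus those of [x] and [y],
     so it is bounded on [I]: this is the quasimorphism defect. *)
  destruct (independent_bounded G Lam (diffset T (sumset T T)) I hind) as [C hC].
  { apply covered_diff; auto; apply covered_sum with l; auto. }
  (* For [x] in [Lam], the vector [f x] sums to [x] minus its remainder; this bounds [f] on
     [Lam]. *)
  destruct (independent_bounded G Lam (diffset Lam T) I hind) as [C' hC'].
  { apply covered_diff; auto; apply covered_self. }
  assert (hquasi : forall g, In g I ->
    quasimorphism (gen Lam) (fun x => IZR (f x g)) (IZR C)).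
  { intros g hg x y hx hy.
    rewrite <- !minus_IZR, <- abs_IZR; apply IZR_le.
    replace (Z.abs (f (tg_add x y) g - f x g - f y g))
      with (Z.abs (f x g - (f (tg_add x y) g - f y g))) by lia.
    apply (hC (fun i => (f x i - (f (tg_add x y) i - f y i))%Z)); [|exact hg].
    rewrite (esum_sub _ _ (f x)), (esum_sub _ _ (f (tg_add x y))).
    exists (tg_sub (tg_add x y) (esum I (f (tg_add x y)))).
    exists (tg_add (tg_sub x (esum I (f x))) (tg_sub y (esum I (f y)))).
    repeat split; [apply hf, gen_add; auto| |abel].
    exists (tg_sub x (esum I (f x))), (tg_sub y (esum I (f y))); auto. }
  destruct (choice_of (fun g (phi : G -> R) =>
    (forall x y, gen Lam x -> gen Lam y -> phi (tg_add x y) = phi x + phi y) /\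
    (In g I -> forall x, gen Lam x -> Rabs (phi x - IZR (f x g)) <= 2 * IZR C) /\
    (~ In g I -> forall x, phi x = 0))) as [phi hphi].
  { intros g; destruct (classic (In g I)) as [hg|hg].
    - destruct (homogenize G (gen Lam) (fun x => IZR (f x g)) (IZR C)) as [p [hp1 hp2]].
      + apply gen0 with l; exact hl.
      + apply gen_add.
      + apply hquasi, hg.
      + exists p; repeat split; auto; contradiction.
    - exists (fun _ => 0); repeat split; intros; try contradiction; lra. }
  exists I, (fun x g => phi g x); repeat split.
  - intros x y hx hy g; apply (hphi g); assumption.
  - intros x g hg; apply (hphi g); exact hg.
  (* The maximum with [0] serves the coordinates outside [I], where [phi] vanishes but the sign of
     the other bound is unknown. *)
  - exists (Rmax 0 (2 * IZR C + IZR C')); intros x hx g.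
    destruct (classic (In g I)) as [hg|hg].
    + eapply Rle_trans; [|apply Rmax_r].
      destruct (hphi g) as (_ & h & _); specialize (h hg x (gen_in _ _ hx)).
      assert (h' : (Z.abs (f x g) <= C')%Z).
      { apply (hC' (f x)); [|exact hg].
        exists x, (tg_sub x (esum I (f x))); repeat split; auto; [|abel].
        apply hf, gen_in, hx. }
      apply IZR_le in h'; rewrite abs_IZR in h'.
      revert h h'; unfold Rabs; repeat destruct Rcase_abs; lra.
    + destruct (hphi g) as (_ & _ & ->); auto.
      rewrite Rabs_R0; apply Rmax_l.
  - intros M.
    (* A bound on [phi x] bounds the integer vector [f x], leaving finitely many sums over [I]; so
       [x] lies in [T] plus a finite set. *)
    destruct (archimed (M + 2 * IZR C)) as [hup _].
    destruct (bounded_esum G (up (M + 2 * IZR C)) I) as [E hE].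
    assert (hTE : covered Lam (sumset T (fun x => In x E))).
    { apply covered_sum with l; auto; apply covered_list with l; auto. }
    revert hTE; apply covered_mono; intros x [hx hM].
    exists (tg_sub x (esum I (f x))), (esum I (f x)); repeat split; auto; [|abel].
    apply hE; intros g hg; apply le_IZR; rewrite abs_IZR.
    destruct (hphi g) as (_ & h & _); specialize (h hg x hx); specialize (hM g).
    revert h hM; unfold Rabs; repeat destruct Rcase_abs; lra.
Qed.

(** * Closed subgroups of Euclidean space *)

Definition near {X : Type} (e : R) (v w : X -> R) : Prop :=
  forall i, Rabs (v i - w i) <= e.

Ltac rabs := unfold Rabs in *; repeat destruct Rcase_abs; lra.

(* The uniform topology on functions supported in a finite list is the Euclidean one. *)
Record closed_subgroup (X : Type) := {
  cs_supp : list X;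
  cs_mem : (X -> R) -> Prop;
  cs_mem0 : cs_mem (fun _ => 0);
  cs_mem_sub : forall v w, cs_mem v -> cs_mem w -> cs_mem (fun i => v i - w i);
  cs_mem_supp : forall v i, cs_mem v -> ~ In i cs_supp -> v i = 0;
  cs_mem_closed : forall v,
    (forall e, 0 < e -> exists w, cs_mem w /\ near e v w) -> cs_mem v
}.

Arguments cs_supp {X}.
Arguments cs_mem {X}.

Definition cs_car {X : Type} (S : closed_subgroup X) : Type := {v : X -> R | cs_mem S v}.

Definition cs_val {X : Type} {S : closed_subgroup X} (v : cs_car S) : X -> R := proj1_sig v.

Lemma cs_val_inj {X : Type} {S : closed_subgroup X} (v w : cs_car S) :
  (forall i, cs_val v i = cs_val w i) -> v = w.
Proof.
  intros h; destruct v as [v hv], w as [w hw]; unfold cs_val in h; simpl in h.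
  assert (e : v = w) by (apply functional_extensionality; exact h).
  subst w; f_equal; apply proof_irrelevance.
Qed.

Definition cs_zero {X : Type} (S : closed_subgroup X) : cs_car S := exist _ _ (cs_mem0 X S).

Lemma cs_mem_opp {X : Type} (S : closed_subgroup X) (v : X -> R) :
  cs_mem S v -> cs_mem S (fun i => - v i).
Proof.
  intros hv.
  replace (fun i => - v i) with (fun i => (fun _ : X => 0) i - v i).
  - apply cs_mem_sub; [apply cs_mem0|exact hv].
  - apply functional_extensionality; intros i; lra.
Qed.

Lemma cs_mem_add {X : Type} (S : closed_subgroup X) (v w : X -> R) :
  cs_mem S v -> cs_mem S w -> cs_mem S (fun i => v i + w i).
Proof.
  intros hv hw.
  replace (fun i => v i + w i) with (fun i => v i - (fun i => - w i) i).
  - apply cs_mem_sub; [exact hv|apply cs_mem_opp, hw].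
  - apply functional_extensionality; intros i; lra.
Qed.

Definition cs_add {X : Type} {S : closed_subgroup X} (v w : cs_car S) : cs_car S :=
  exist _ _ (cs_mem_add S _ _ (proj2_sig v) (proj2_sig w)).

Definition cs_opp {X : Type} {S : closed_subgroup X} (v : cs_car S) : cs_car S :=
  exist _ _ (cs_mem_opp S _ (proj2_sig v)).

Definition cs_open {X : Type} {S : closed_subgroup X} (U : set (cs_car S)) : Prop :=
  forall v, U v -> exists e, 0 < e /\ forall w, near e (cs_val w) (cs_val v) -> U w.

(** The uniform bound [d < r] expresses that the sup distance is below [r] without forming a
    supremum. *)
Definition cs_ball {X : Type} {S : closed_subgroup X} (v : cs_car S) (r : R) : set (cs_car S) :=
  fun w => exists d, d < r /\ near d (cs_val w) (cs_val v).

Lemma cs_ball_open {X : Type} {S : closed_subgroup X} (v : cs_car S) (r : R) :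
  cs_open (cs_ball v r).
Proof.
  intros w (d & hd & hw); exists ((r - d) / 2); split; [lra|].
  intros u hu; exists (d + (r - d) / 2); split; [lra|].
  intros i; specialize (hw i); specialize (hu i); rabs.
Qed.

Lemma cs_ball_center {X : Type} {S : closed_subgroup X} (v : cs_car S) (r : R) :
  0 < r -> cs_ball v r v.
Proof.
  intros hr; exists 0; split; [exact hr|]; intros i.
  rewrite Rminus_diag, Rabs_R0; lra.
Qed.

Lemma cs_open_union {X : Type} {S : closed_subgroup X} (I : Type) (U : I -> set (cs_car S)) :
  (forall i, cs_open (U i)) -> cs_open (fun x => exists i, U i x).
Proof.
  intros hU v [i hi]; destruct (hU i v hi) as (e & he & h).
  exists e; split; [exact he|]; intros w hw; exists i; auto.
Qed.

Lemma cs_open_inter {X : Type} {S : closed_subgroup X} (U V : set (cs_car S)) :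
  cs_open U -> cs_open V -> cs_open (fun x => U x /\ V x).
Proof.
  intros hU hV v [h1 h2].
  destruct (hU v h1) as (e & he & h), (hV v h2) as (e' & he' & h').
  exists (Rmin e e'); split; [apply Rmin_pos; assumption|].
  intros w hw; split; [apply h|apply h']; intros i; (eapply Rle_trans; [apply hw|]).
  - apply Rmin_l.
  - apply Rmin_r.
Qed.

Lemma cs_add_cont {X : Type} {S : closed_subgroup X} (W : set (cs_car S)) (x y : cs_car S) :
  cs_open W -> W (cs_add x y) ->
  exists U V : set (cs_car S), cs_open U /\ cs_open V /\ U x /\ V y /\
    (forall u v, U u -> V v -> W (cs_add u v)).
Proof.
  intros hW hxy; destruct (hW _ hxy) as (e & he & h).
  exists (cs_ball x (e / 2)), (cs_ball y (e / 2)).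
  repeat split; try apply cs_ball_open; try (apply cs_ball_center; lra).
  intros u v (d & hd & hu) (d' & hd' & hv); apply h; intros i; simpl.
  specialize (hu i); specialize (hv i); unfold cs_val in *; rabs.
Qed.

Lemma cs_opp_cont {X : Type} {S : closed_subgroup X} (W : set (cs_car S)) (x : cs_car S) :
  cs_open W -> W (cs_opp x) ->
  exists U : set (cs_car S), cs_open U /\ U x /\ (forall u, U u -> W (cs_opp u)).
Proof.
  intros hW hx; destruct (hW _ hx) as (e & he & h).
  exists (cs_ball x e); repeat split; [apply cs_ball_open|apply cs_ball_center; lra|].
  intros u (d & hd & hu); apply h; intros i; simpl.
  specialize (hu i); unfold cs_val in *; rabs.
Qed.

Lemma cs_hausdorff {X : Type} {S : closed_subgroup X} (x y : cs_car S) : x <> y ->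
  exists U V : set (cs_car S), cs_open U /\ cs_open V /\ U x /\ V y /\
    (forall z, U z -> V z -> False).
Proof.
  intros hxy.
  assert (hi : exists i, cs_val x i <> cs_val y i).
  { apply NNPP; intros no; apply hxy, cs_val_inj; intros i.
    apply NNPP; intros h; apply no; exists i; exact h. }
  destruct hi as [i hi].
  assert (hd : 0 < Rabs (cs_val x i - cs_val y i)) by (apply Rabs_pos_lt; lra).
  set (r := Rabs (cs_val x i - cs_val y i)) in *.
  exists (cs_ball x (r / 2)), (cs_ball y (r / 2)).
  repeat split; try apply cs_ball_open; try (apply cs_ball_center; lra).
  intros z (d & hd1 & h1) (d' & hd2 & h2); specialize (h1 i); specialize (h2 i).
  unfold r in *; rabs.
Qed.

(** It is transparent so that later proofs can compute its carrier and operations. *)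
Definition cs_group {X : Type} (S : closed_subgroup X) : TopAbGroup.
Proof.
  refine (@Build_TopAbGroup (cs_car S) (cs_zero S) cs_add cs_opp cs_open
            _ _ _ _ _ _ cs_open_union cs_open_inter cs_add_cont cs_opp_cont cs_hausdorff).
  - intros x y z; apply cs_val_inj; intros i; simpl; unfold cs_val; simpl; ring.
  - intros x y; apply cs_val_inj; intros i; simpl; unfold cs_val; simpl; ring.
  - intros x; apply cs_val_inj; intros i; simpl; unfold cs_val; simpl; ring.
  - intros x; apply cs_val_inj; intros i; simpl; unfold cs_val; simpl; ring.
  - intros U V hUV hU v hv; destruct (hU v) as (e & he & h); [apply hUV, hv|].
    exists e; split; [exact he|]; intros w hw; apply hUV, h, hw.
  - intros v _; exists 1; split; [lra|auto].
Defined.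

(** * Compactness *)

(** Bisection arguments need only this: if a set is not small and is covered by two pieces, one of
    the pieces is not small. The instance of interest is having a finite subcover. *)
Definition ideal {T : Type} (small : set T -> Prop) : Prop :=
  small (fun _ => False) /\
  (forall A B : set T, (forall x, A x -> B x) -> small B -> small A) /\
  (forall A B : set T, small A -> small B -> small (fun x => A x \/ B x)).

Lemma finite_subcover_ideal {T I : Type} (U : I -> set T) :
  ideal (fun A => exists l : list I, forall x, A x -> exists i, In i l /\ U i x).
Proof.
  repeat split.
  - exists []; intros x [].
  - intros A B hAB [l hl]; exists l; auto.
  - intros A B [l hl] [m hm]; exists (l ++ m); intros x [hx|hx].
    + destruct (hl x hx) as (i & hi & h); exists i; split; [apply in_or_app|]; auto.
    + destruct (hm x hx) as (i & hi & h); exists i; split; [apply in_or_app|]; auto.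
Qed.

(** The range of [c] is cut into intervals of length [e]; if every slice were small, so would be
    their finite union. The induction drops the bottom slice when it is small and returns it
    otherwise. *)
Lemma ideal_shrink {T : Type} (small : set T -> Prop) (c : T -> R) (M e : R) (A : set T) :
  ideal small -> 0 < e -> ~ small A -> (forall x, A x -> Rabs (c x) <= M) ->
  exists B : set T, (forall x, B x -> A x) /\ ~ small B /\
    forall x y, B x -> B y -> Rabs (c x - c y) <= e.
Proof.
  intros (_ & hmono & hU) he hA hM.
  assert (hN : exists N : nat, forall x, A x -> - M <= c x <= - M + INR N * e).
  { destruct (INR_unbounded (2 * M / e)) as [N hN]; exists N; intros x hx.
    apply (Rmult_lt_compat_r e) in hN; [|exact he].
    replace (2 * M / e * e) with (2 * M) in hN by (field; lra).
    specialize (hM x hx); rabs. }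
  (* The left endpoint is generalized because dropping a slice moves it. *)
  destruct hN as [N hN]; clear hM; revert A hA hN; generalize (- M) as a.
  induction N as [|N IH]; intros a A hA hN.
  - exists A; repeat split; auto; intros x y hx hy.
    apply hN in hx, hy; simpl in hx, hy; rabs.
  - destruct (classic (small (fun x => A x /\ c x <= a + e))) as [h|h].
    + destruct (IH (a + e) (fun x => A x /\ a + e < c x)) as (B & hBA & hB & hd).
      * intros h'; apply hA; eapply hmono; [|apply (hU _ _ h h')].
        intros x hx; simpl; destruct (Rle_or_lt (c x) (a + e)); auto.
      * intros x [hx hlt]; apply hN in hx; rewrite S_INR in hx; lra.
      * exists B; repeat split; auto; intros x hx; apply (hBA x hx).
    + exists (fun x => A x /\ c x <= a + e); repeat split; auto.
      * intros x [hx _]; exact hx.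
      * intros x y [hx hx'] [hy hy']; apply hN in hx, hy; rabs.
Qed.

Lemma ideal_shrink_list {T X : Type} (small : set T -> Prop) (c : X -> T -> R) (M e : R)
    (l : list X) (A : set T) :
  ideal small -> 0 < e -> ~ small A -> (forall i x, A x -> Rabs (c i x) <= M) ->
  exists B : set T, (forall x, B x -> A x) /\ ~ small B /\
    forall i x y, In i l -> B x -> B y -> Rabs (c i x - c i y) <= e.
Proof.
  intros hs he hA hM; induction l as [|i l (B & hBA & hB & hd)].
  - exists A; repeat split; auto; intros i x y [].
  - destruct (ideal_shrink small (c i) M e B) as (B' & hBB & hB' & hd'); auto.
    exists B'; repeat split; auto; intros j x y [<-|hj] hx hy; auto.
Qed.

Lemma cs_shrink {X : Type} (S : closed_subgroup X) (small : set (cs_car S) -> Prop)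
    (M e : R) (A : set (cs_car S)) :
  ideal small -> 0 < e -> ~ small A -> (forall x i, A x -> Rabs (cs_val x i) <= M) ->
  exists B : set (cs_car S), (forall x, B x -> A x) /\ ~ small B /\
    forall x y, B x -> B y -> near e (cs_val x) (cs_val y).
Proof.
  intros hs he hA hM.
  destruct (ideal_shrink_list small (fun i x => cs_val x i) M e (cs_supp S) A)
    as (B & hBA & hB & hd); auto.
  exists B; repeat split; auto; intros x y hx hy i.
  destruct (classic (In i (cs_supp S))) as [hi|hi]; [apply (hd i x y hi hx hy)|].
  unfold cs_val.
  rewrite (cs_mem_supp X S _ i (proj2_sig x) hi), (cs_mem_supp X S _ i (proj2_sig y) hi).
  rewrite Rminus_diag, Rabs_R0; lra.
Qed.

Lemma inv_INR_small (e : R) : 0 < e -> exists n : nat, / INR (S n) <= e.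
Proof.
  intros he; destruct (INR_unbounded (/ e)) as [n hn]; exists n.
  rewrite <- (Rinv_inv e); apply Rinv_le_contravar; [apply Rinv_0_lt_compat, he|].
  rewrite S_INR; lra.
Qed.

(** Coordinates converge by completeness of the reals. The rate passes to the limit uniformly in the
    coordinate, and closedness keeps the limit in the subgroup. *)
Lemma cs_complete {X : Type} (S : closed_subgroup X) (x : nat -> cs_car S) :
  (forall n m, (n <= m)%nat -> near (/ INR (Datatypes.S n)) (cs_val (x m)) (cs_val (x n))) ->
  exists v : cs_car S, forall n, near (/ INR (Datatypes.S n)) (cs_val v) (cs_val (x n)).
Proof.
  intros hx.
  assert (hlim : forall i, exists l, Un_cv (fun n => cs_val (x n) i) l).
  { intros i; destruct (R_complete (fun n => cs_val (x n) i)) as [l hl]; [|exists l; exact hl].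
    intros e he; destruct (inv_INR_small (e / 3)) as [N hN]; [lra|].
    exists N; intros n m hn hm.
    assert (h1 := hx N n hn i); assert (h2 := hx N m hm i).
    unfold Rdist; rabs. }
  destruct (choice_of _ hlim) as [v hv].
  assert (hnear : forall n, near (/ INR (Datatypes.S n)) v (cs_val (x n))).
  { intros n i; apply Rle_plus_epsilon; intros e he.
    destruct (hv i e he) as [N hN].
    specialize (hN (Nat.max N n) (Nat.le_max_l _ _)).
    assert (h := hx n (Nat.max N n) (Nat.le_max_r _ _) i).
    unfold Rdist in hN; rabs. }
  assert (hmem : cs_mem S v).
  { apply cs_mem_closed; intros e he; destruct (inv_INR_small e he) as [n hn].
    exists (cs_val (x n)); split; [apply (proj2_sig (x n))|].
    intros i; specialize (hnear n i); lra. }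
  exists (exist _ v hmem); exact hnear.
Qed.

Definition cs_bounded {X : Type} {S : closed_subgroup X} (A : set (cs_car S)) : Prop :=
  exists M, forall x i, A x -> Rabs (cs_val x i) <= M.

(** Heine-Borel: without a finite subcover, nested subsets of vanishing diameter, none with a finite
    subcover, shrink to a point of [A]. The member of the cover at that point swallows one of
    them. *)
Lemma cs_compact {X : Type} (S : closed_subgroup X) (A : set (cs_group S)) :
  (forall x, closure_wrt tg_open A x -> A x) -> cs_bounded A -> compact A.
Proof.
  intros hcl [M hM] I U hU hcov.
  set (small := fun A : set (cs_car S) =>
    exists l : list I, forall x, A x -> exists i, In i l /\ U i x).
  assert (hid : ideal small) by apply finite_subcover_ideal.
  apply NNPP; intros hA; change (~ small A) in hA.
  destruct (choice_of (fun (p : nat * set (cs_car S)) B =>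
    ~ small (snd p) -> (forall x, snd p x -> A x) ->
    (forall x, B x -> snd p x) /\ ~ small B /\
    forall x y, B x -> B y -> near (/ INR (Datatypes.S (fst p))) (cs_val x) (cs_val y)))
    as [step hstep].
  { intros [n B]; simpl.
    destruct (classic (~ small B /\ forall x, B x -> A x)) as [[h1 h2]|h].
    - destruct (cs_shrink S small M (/ INR (Datatypes.S n)) B) as (B' & hB'); auto.
      + apply Rinv_0_lt_compat, lt_0_INR; lia.
      + exists B'; auto.
    - exists B; intros h1 h2; destruct h; auto. }
  set (B := nat_rect (fun _ => set (cs_car S)) A (fun n B => step (n, B))).
  assert (hB : forall n, ~ small (B n) /\ forall x, B n x -> A x).
  { induction n as [|n [h1 h2]]; [split; auto|].
    destruct (hstep (n, B n) h1 h2) as (h & h' & _); split; auto.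
    intros x hx; apply h2, h, hx. }
  assert (hdec : forall n m, (n <= m)%nat -> forall x, B m x -> B n x).
  { intros n m hnm; induction hnm as [|m hnm IH]; auto.
    intros x hx; apply IH; destruct (hB m) as [h1 h2].
    apply (hstep (m, B m) h1 h2); exact hx. }
  assert (hdiam : forall n x y, B (Datatypes.S n) x -> B (Datatypes.S n) y ->
    near (/ INR (Datatypes.S n)) (cs_val x) (cs_val y)).
  { intros n; destruct (hB n) as [h1 h2]; apply (hstep (n, B n) h1 h2). }
  (* These sets are nonempty because the empty list covers the empty set. The index is shifted since
     [B 0 = A] has no diameter bound. *)
  destruct (choice_of (fun n x => B (Datatypes.S n) x)) as [x hx].
  { intros n; apply NNPP; intros no; destruct (hB (Datatypes.S n)) as [h _]; apply h.
    exists []; intros y hy; destruct no; exists y; exact hy. }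
  destruct (cs_complete S x) as [v hv].
  { intros n m hnm; apply hdiam; [|apply hx].
    apply (hdec (Datatypes.S n) (Datatypes.S m)); [lia|apply hx]. }
  assert (hAv : A v).
  { apply hcl; intros V hV hVv; destruct (hV v hVv) as (e & he & h).
    destruct (inv_INR_small e he) as [n hn].
    exists (x n); split; [apply (hB (Datatypes.S n)), hx|].
    apply h; intros i; specialize (hv n i); rabs. }
  destruct (hcov v hAv) as [i hi]; destruct (hU i v hi) as (e & he & h).
  destruct (inv_INR_small (e / 2)) as [n hn]; [lra|].
  destruct (hB (Datatypes.S n)) as [hns _]; apply hns.
  exists [i]; intros y hy; exists i; split; [simpl; auto|].
  apply h; intros j; specialize (hv n j); specialize (hdiam n y (x n) hy (hx n) j); rabs.
Qed.

Lemma cs_precompact {X : Type} (S : closed_subgroup X) (A : set (cs_group S)) :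
  cs_bounded A -> precompact A.
Proof.
  intros [M hM]; apply cs_compact.
  - intros x hx V hV hVx; destruct (hx V hV hVx) as (a & ha & hVa); apply (ha V hV hVa).
  - exists (M + 1); intros x i hx.
    destruct (hx (cs_ball x 1) (cs_ball_open x 1)) as (a & ha & d & hd & hax).
    + apply cs_ball_center; lra.
    + specialize (hM a i ha); specialize (hax i); rabs.
Qed.

Lemma cs_val_bounded {X : Type} (S : closed_subgroup X) (x : cs_car S) :
  exists M, forall i, Rabs (cs_val x i) <= M.
Proof.
  assert (h : exists M, 0 <= M /\ forall i, In i (cs_supp S) -> Rabs (cs_val x i) <= M).
  { induction (cs_supp S) as [|i l (M & h0 & hM)].
    - exists 0; split; [lra|intros i []].
    - exists (M + Rabs (cs_val x i)); assert (h := Rabs_pos (cs_val x i)); split; [lra|].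
      intros j [<-|hj]; [lra|specialize (hM j hj); lra]. }
  destruct h as (M & h0 & hM); exists M; intros i.
  destruct (classic (In i (cs_supp S))) as [hi|hi]; auto.
  unfold cs_val; rewrite (cs_mem_supp X S _ i (proj2_sig x) hi), Rabs_R0; exact h0.
Qed.

Lemma closure_incl (G : TopAbGroup) (A : set G) (x : G) : A x -> closure_wrt tg_open A x.
Proof. intros hx V _ hV; exists x; auto. Qed.

Lemma cs_locally_compact {X : Type} (S : closed_subgroup X) : locally_compact (cs_group S).
Proof.
  intros x; exists (cs_ball x 1), (closure_wrt (@tg_open (cs_group S)) (cs_ball x 1)).
  repeat split.
  - apply cs_ball_open.
  - apply cs_precompact; destruct (cs_val_bounded S x) as [M hM].
    exists (M + 1); intros y i (d & hd & hy); specialize (hM i); specialize (hy i); rabs.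
  - apply cs_ball_center; lra.
  - intros y; apply (closure_incl (cs_group S)).
Qed.

(** * Translates, local finiteness and products *)

Lemma open_local (G : TopAbGroup) (A : set G) :
  (forall x, A x -> exists U : set G, tg_open U /\ U x /\ forall y, U y -> A y) -> tg_open A.
Proof.
  intros h.
  apply (@tg_open_ext G (fun x => exists p : {U : set G | tg_open U /\ forall y, U y -> A y},
    proj1_sig p x)).
  - intros x; split.
    + intros [[U [hU hUA]] hUx]; apply hUA, hUx.
    + intros hx; destruct (h x hx) as (U & hU & hUx & hUA).
      exists (exist _ U (conj hU hUA)); exact hUx.
  - apply tg_open_union; intros [U [hU hUA]]; exact hU.
Qed.

Lemma open_translate (G : TopAbGroup) (A : set G) (a : G) :
  tg_open A -> tg_open (fun x => A (tg_add x a)).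
Proof.
  intros hA; apply open_local; intros x hx.
  destruct (tg_add_cont G A x a hA hx) as (U & V & hU & _ & hUx & hVa & h).
  exists U; repeat split; auto.
Qed.

Lemma compact_translate (G : TopAbGroup) (K : set G) (a : G) :
  compact K -> compact (fun x => K (tg_add x a)).
Proof.
  intros hK I U hU hcov.
  destruct (hK I (fun i x => U i (tg_add x (tg_opp a)))) as [l hl].
  - intros i; apply open_translate, hU.
  - intros x hx; apply hcov.
    replace (tg_add (tg_add x (tg_opp a)) a) with x by abel; exact hx.
  - exists l; intros x hx; destruct (hl _ hx) as (i & hi & h); exists i; split; auto.
    replace x with (tg_add (tg_add x a) (tg_opp a)) by abel; exact h.
Qed.

(** The part of [Lam + e] in [K] is a translate of the part of [Lam] in the compact set [K - e];
    finitely many [e] occur. *)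
Lemma covered_locally_finite (G : TopAbGroup) (Lam S K : set G) :
  locally_finite Lam -> covered Lam S -> compact K -> finite_set (fun x => S x /\ K x).
Proof.
  intros hLam [E hE] hK.
  assert (h : exists l : list G, forall z e, Lam z -> In e E -> K (tg_add z e) ->
    In (tg_add z e) l).
  { clear hE; induction E as [|e E [l hl]].
    - exists []; intros z e _ [].
    - destruct (hLam _ (compact_translate G K e hK)) as [m hm].
      exists (map (fun z => tg_add z e) m ++ l).
      intros z f hz [<-|hf] hzf; apply in_or_app; [left|right; auto].
      apply (in_map (fun z => tg_add z e)), hm; auto. }
  destruct h as [l hl]; exists l; intros x [hx hKx].
  destruct (hE x hx) as (z & e & hz & he & ->); auto.
Qed.

Lemma isolate_in_list (G : TopAbGroup) (x : G) (l : list G) :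
  exists U : set G, tg_open U /\ U x /\ forall y, In y l -> U y -> y = x.
Proof.
  induction l as [|y l (U & hU & hx & h)].
  - exists (fun _ => True); repeat split; [apply tg_open_full|intros y []].
  - destruct (classic (y = x)) as [hyx|hyx].
    + exists U; repeat split; auto; intros z [<-|hz]; auto.
    + destruct (tg_hausdorff G hyx) as (V & W & _ & hW & hVy & hWx & hVW).
      exists (fun z => U z /\ W z); repeat split; auto; [apply tg_open_inter; auto|].
      intros z [<-|hz] [h1 h2]; auto; destruct (hVW y hVy h2).
Qed.

(** Tube lemma: compactness of [C] gives each [k] in [K] a neighbourhood whose product with [C] is
    finitely covered, and compactness of [K] selects finitely many such tubes. *)
Lemma compact_prod (G H : TopAbGroup) (K : set G) (C : set H) :
  compact K -> compact C ->
  compact_wrt (@prod_open G H) (fun p => K (fst p) /\ C (snd p)).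
Proof.
  intros hK hC I U hU hcov.
  set (tube := fun (A : set G) (l : list I) => tg_open A /\
    forall a c, A a -> C c -> exists i, In i l /\ U i (a, c)).
  assert (htube : forall k, K k -> exists A l, A k /\ tube A l).
  { intros k hk.
    (* The cover of [C] is indexed by all open rectangles over [k] contained in some [U i], which
       avoids choosing one for each point. *)
    destruct (hC {q : I * set G * set H |
      tg_open (snd (fst q)) /\ tg_open (snd q) /\ snd (fst q) k /\
      forall a b, snd (fst q) a -> snd q b -> U (fst (fst q)) (a, b)}
      (fun q => snd (proj1_sig q))) as [l hl].
    - intros [[[i A] B] (h1 & h2 & h3)]; exact h2.
    - intros c hc; destruct (hcov (k, c)) as [i hi]; [split; assumption|].
      destruct (hU i _ hi) as (A & B & hA & hB & hAk & hBc & h).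
      exists (exist _ (i, A, B) (conj hA (conj hB (conj hAk h)))); exact hBc.
    - enough (h : exists A l', A k /\ tg_open A /\ forall a c, A a ->
                (exists q, In q l /\ snd (proj1_sig q) c) ->
                exists i, In i l' /\ U i (a, c)).
      { destruct h as (A & l' & hAk & hA & h); exists A, l'; repeat split; auto. }
      clear hl; induction l as [|q l (A & l' & hAk & hA & IH)].
      + exists (fun _ => True), []; repeat split; [apply tg_open_full|].
        intros a c _ (q & [] & _).
      + destruct q as [[[i B] D] (hB & hD & hBk & hq)]; simpl in *.
        exists (fun x => A x /\ B x), (i :: l'); repeat split; auto.
        { apply tg_open_inter; auto. }
        intros a c [ha hb] (q & [<-|hql] & hqc); simpl in *.
        * exists i; auto.
        * destruct (IH a c ha) as (j & hj & hUj); [exists q; auto|exists j; auto]. }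
  destruct (hK {q : set G * list I | tube (fst q) (snd q)}
              (fun q => fst (proj1_sig q))) as [l hl].
  - intros [q hq]; apply hq.
  - intros k hk; destruct (htube k hk) as (A & l & hAk & ht).
    exists (exist _ (A, l) ht); exact hAk.
  - exists (flat_map (fun q => snd (proj1_sig q)) l); intros [k c] [hk hc].
    destruct (hl k hk) as ([[A m] [hA ht]] & hq & hAk); simpl in *.
    destruct (ht k c hAk hc) as (i & hi & hUi); exists i; split; auto.
    apply in_flat_map; eexists; split; [exact hq|exact hi].
Qed.

(** * The cut and project scheme *)

Definition uniform_closure {G : TopAbGroup} (L : set G) (phi : G -> G -> R) : set (G -> R) :=
  fun v => forall e, 0 < e -> exists x, L x /\ near e v (phi x).

(** Taking the closure of the image, rather than the whole Euclidean space, makes the star image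
    dense in the internal group. *)
Lemma exists_closure_group (G : TopAbGroup) (L : set G) (I : list G) (phi : G -> G -> R) :
  L tg_zero -> (forall x y, L x -> L y -> L (tg_sub x y)) ->
  (forall x y, L x -> L y -> forall g, phi (tg_sub x y) g = phi x g - phi y g) ->
  (forall x g, ~ In g I -> phi x g = 0) ->
  exists S : closed_subgroup G, cs_mem S = uniform_closure L phi.
Proof.
  intros hL0 hLs hphi hI.
  unshelve eexists (@Build_closed_subgroup G I (uniform_closure L phi) _ _ _ _).
  - intros e he; exists tg_zero; split; auto; intros i.
    replace (phi tg_zero i) with 0.
    + rewrite Rminus_diag, Rabs_R0; lra.
    + replace (tg_zero : G) with (tg_sub (tg_zero : G) tg_zero) by abel.
      rewrite hphi; auto; lra.
  - intros v w hv hw e he.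
    destruct (hv (e / 2)) as (x & hx & hvx); [lra|].
    destruct (hw (e / 2)) as (y & hy & hwy); [lra|].
    exists (tg_sub x y); split; auto; intros i; rewrite hphi by auto.
    specialize (hvx i); specialize (hwy i); rabs.
  - intros v i hv hi; apply NNPP; intros h.
    destruct (hv (Rabs (v i) / 2)) as (x & _ & hx).
    + assert (h' := Rabs_pos_lt _ h); lra.
    + specialize (hx i); rewrite hI, Rminus_0_r in hx by exact hi.
      assert (h' := Rabs_pos_lt _ h); lra.
  - intros v hv e he.
    destruct (hv (e / 2)) as (w & hw & hvw); [lra|].
    destruct (hw (e / 2)) as (x & hx & hwx); [lra|].
    exists x; split; auto; intros i; specialize (hvw i); specialize (hwx i); rabs.
  - reflexivity.
Qed.

Lemma star_graph_cut_and_project (G : TopAbGroup) (Lam K : set G) (l0 : G)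
    (phi : G -> G -> R) (C : R) (S : closed_subgroup G) :
  locally_compact G -> locally_finite Lam -> Lam l0 -> compact K ->
  (forall g, exists l k, Lam l /\ K k /\ g = tg_add l k) ->
  (forall x y, gen Lam x -> gen Lam y -> forall g,
     phi (tg_sub x y) g = phi x g - phi y g) ->
  (forall x, Lam x -> forall g, Rabs (phi x g) <= C) ->
  (forall M, covered Lam (fun x => gen Lam x /\ forall g, Rabs (phi x g) <= M)) ->
  cs_mem S = uniform_closure (gen Lam) phi ->
  @cut_and_project G (cs_group S)
    (fun p => gen Lam (fst p) /\ forall g, cs_val (snd p) g = phi (fst p) g).
Proof.
  intros hlc hlf hl0 hK hrd hphi hC hfin hS.
  assert (hadd : forall x y, gen Lam x -> gen Lam y -> forall g,
     phi (tg_add x y) g = phi x g + phi y g).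
  { intros x y hx hy g; assert (h := hphi _ _ (gen_add _ _ _ _ hx hy) hy g).
    replace (tg_sub (tg_add x y) y) with x in h by abel; lra. }
  assert (hg0 : gen Lam tg_zero) by (apply gen0 with l0; exact hl0).
  assert (hlift : forall x, gen Lam x ->
    exists h : cs_car S, forall g, cs_val h g = phi x g).
  { intros x hx; assert (hm : cs_mem S (phi x)).
    { rewrite hS; intros e he; exists x; split; auto; intros i.
      rewrite Rminus_diag, Rabs_R0; lra. }
    exists (exist _ (phi x) hm); reflexivity. }
  assert (happrox : forall (h : cs_car S) e, 0 < e ->
    exists x, gen Lam x /\ near e (cs_val h) (phi x)).
  { intros h; change (uniform_closure (gen Lam) phi (cs_val h)).
    rewrite <- hS; exact (proj2_sig h). }
  split; [|split; [|split; [|split]]].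
  - split.
    + split; [exact hg0|]; intros g; simpl; unfold cs_val; simpl.
      assert (h := hadd _ _ hg0 hg0 g); rewrite tg_add0 in h; lra.
    + intros [x v] [y w] [hx hv] [hy hw]; simpl in *; split; [apply gen_sub; auto|].
      intros g; rewrite hphi, <- hv, <- hw by auto; unfold cs_val; simpl; ring.
  (* Discreteness: for a lattice point [(y, w)] near [(x, v)], the difference [y - x] has [phi]
     bounded by 1 and lies in a compact set. Only finitely many [y] remain, and the Hausdorff
     property separates them from [x]. *)
  - intros [x v] [hx hv]; simpl in hx, hv.
    destruct (hlc x) as (U & Kx & hU & hKx & hUx & hUK).
    destruct (covered_locally_finite G Lam _ (fun y => Kx (tg_add y x)) hlf (hfin 1))
      as [m hm]; [apply compact_translate, hKx|].
    destruct (isolate_in_list G x (map (fun y => tg_add y x) m)) as (V & hV & hVx & hiso).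
    exists (fun p => (U (fst p) /\ V (fst p)) /\ cs_ball v 1 (snd p)); split; [|split].
    + intros [y w] [hy hw]; exists (fun z => U z /\ V z), (cs_ball v 1).
      split; [apply tg_open_inter; auto|].
      split; [apply cs_ball_open|]; repeat split; simpl in *; tauto.
    + repeat split; auto; apply cs_ball_center; lra.
    + intros [y w] [hy hw] [[hUy hVy] (d & hd & hvw)]; simpl in *.
      assert (e : y = x).
      { apply hiso; auto.
        replace y with (tg_add (tg_sub y x) x) by abel.
        apply (in_map (fun z => tg_add z x)), hm; repeat split.
        - apply gen_sub; auto.
        - intros g; rewrite hphi, <- hw, <- hv by auto; specialize (hvw g); lra.
        - replace (tg_add (tg_sub y x) x) with y by abel; auto. }
      subst y; f_equal; apply cs_val_inj; intros g; rewrite hw, hv; reflexivity.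
  - intros J U hU hinv hcov.
    (* [K] times the closure of [D] is compact and meets every coset of the lattice, so a finite
       subcover of it suffices for an invariant cover. *)
    set (D := fun h : cs_car S => forall g, Rabs (cs_val h g) <= C + 1).
    assert (hD : precompact (D : set (cs_group S))).
    { apply cs_precompact; exists (C + 1); intros h g hh; apply hh. }
    destruct (compact_prod G (cs_group S) K _ hK hD J U hU) as [li hli]; [auto|].
    exists li; intros [g h].
    (* Choose [x] with [phi x] within 1 of [h] and write [g - x = l + k]. Subtracting the lattice
       point over [x + l] leaves [k] in [K] and an internal part bounded by [C + 1]. *)
    destruct (happrox h 1) as (x & hx & hhx); [lra|].
    destruct (hrd (tg_sub g x)) as (l & k & hl & hk & hgx).
    assert (hxl : gen Lam (tg_add x l)) by (apply gen_add; [|apply gen_in]; auto).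
    destruct (hlift _ hxl) as [w hw].
    destruct (hli (k, @tg_sub (cs_group S) h w)) as (i & hi & hUi).
    + split; [exact hk|]; apply closure_incl; intros j.
      assert (e := hadd x l hx (gen_in _ _ hl) j); rewrite <- hw in e.
      specialize (hC l hl j); specialize (hhx j); unfold cs_val in *; simpl in *; rabs.
    + exists i; split; auto.
      replace (g, h) with
        (@prod_add G (cs_group S) (k, @tg_sub (cs_group S) h w) (tg_add x l, w)).
      * apply hinv; auto.
      * unfold prod_add; simpl; f_equal.
        -- transitivity (tg_add (tg_add l k) x); [abel|]; rewrite <- hgx; abel.
        -- apply (tg_subrK (cs_group S)).
  - intros [x v] [y w] [hx hv] [hy hw]; simpl in *; intros <-; f_equal.
    apply cs_val_inj; intros g; rewrite hv, hw; reflexivity.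
  - intros h V hV hh; destruct (hV h hh) as (e & he & hball).
    destruct (happrox h e he) as (x & hx & hhx); destruct (hlift x hx) as [w hw].
    exists w; split; [exists (x, w); auto|].
    apply hball; intros g; rewrite hw, Rabs_minus_sym; apply hhx.
Qed.

Theorem theorem7p4 (G : TopAbGroup) (HlcG : locally_compact G)
  (HsG : sigma_compact G) (Lam : set G) (HLam : almost_lattice Lam) :
  exists (H : TopAbGroup) (L : set (G * H)) (W : set H),
    locally_compact H /\ cut_and_project L /\
    precompact W /\ nonempty_interior W /\
    (forall x, Lam x -> model_set L W x).
Proof.
  destruct HLam as ((K & hK & hrd) & hlf & F & hF).
  (* Relative denseness at zero provides a point of [Lam]. *)
  destruct (hrd tg_zero) as (l0 & _ & hl0 & _ & _).
  assert (hd : covered Lam (diffset Lam Lam)).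
  { exists F; intros x (s & t & hs & ht & ->); apply hF; assumption. }
  destruct (exists_star_map G Lam l0 hl0 hd) as (I & phi & hadd & hI & (C & hC) & hfin).
  assert (hphi : forall x y, gen Lam x -> gen Lam y -> forall g,
     phi (tg_sub x y) g = phi x g - phi y g).
  { intros x y hx hy g; assert (h := hadd _ _ (gen_sub _ _ _ hx hy) hy g).
    replace (tg_add (tg_sub x y) y) with x in h by abel; lra. }
  destruct (exists_closure_group G (gen Lam) I phi) as [S hS]; auto.
  { apply gen0 with l0; exact hl0. }
  { apply gen_sub. }
  exists (cs_group S), (fun p => gen Lam (fst p) /\ forall g, cs_val (snd p) g = phi (fst p) g).
  (* Whatever the sign of [C], the radius [Rabs C + 1] is at least 1, so the window contains the
     unit ball as well as the star image of [Lam]. *)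
  exists (fun h => forall g, Rabs (cs_val h g) <= Rabs C + 1).
  split; [apply cs_locally_compact|].
  split; [apply star_graph_cut_and_project with K l0 C; auto|].
  split; [apply cs_precompact; exists (Rabs C + 1); auto|].
  split.
  - exists (cs_ball (cs_zero S) 1); split; [apply cs_ball_open|]; split.
    + exists (cs_zero S); apply cs_ball_center; lra.
    + intros v (d & hdr & hv) g; specialize (hv g); assert (h := Rabs_pos C).
      unfold cs_zero, cs_val in *; simpl in *; rewrite Rminus_0_r in hv; lra.
  - intros x hx.
    assert (hm : cs_mem S (phi x)).
    { rewrite hS; intros e he; exists x; split; [apply gen_in, hx|]; intros i.
      rewrite Rminus_diag, Rabs_R0; lra. }
    exists (x, exist _ (phi x) hm); repeat split; [apply gen_in, hx|].
    intros g; specialize (hC x hx g); unfold cs_val; simpl.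
    assert (h := Rle_abs C); lra.
Qed.
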